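(* Any abelian complex structure on the Lie algebra $\mathfrak h_5$ admits balanced Hermitian metrics.
   Context: $\mathfrak h_5$ is the $6$-dimensional nilpotent Lie algebra whose dual has a basis with $de^1=\cdots=de^4=0$, $de^5=e^1\wedge e^3+e^4\wedge e^2$, $de^6=e^1\wedge e^4+e^2\wedge e^3$, where $d$ is the Chevalley-Eilenberg differential. A complex structure on a Lie algebra $\mathfrak g$ is an endomorphism $J$ with $J^2=-\mathrm{Id}$ and $[JX,JY]=J[JX,Y]+J[X,JY]+[X,Y]$; it is abelian if $[JX,JY]=[X,Y]$ for all $X,Y$. A Hermitian metric for $J$ is an inner product $g$ on $\mathfrak g$ with $g(\cdot,\cdot)=g(J\cdot,J\cdot)$; with $F(X,Y)=g(X,JY)$ it is balanced if $d(F\wedge F)=0$. *)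

(* Defs.v *)
From HB Require Import structures.
From mathcomp Require Import all_boot all_order fingroup perm all_algebra.
From mathcomp Require Import reals.

Set Implicit Arguments.
Unset Strict Implicit.
Unset Printing Implicit Defensive.

Import GRing.Theory Num.Theory.
Local Open Scope ring_scope.

HB.mixin Record Vector_isLieAlgebra (R : fieldType) (V : Type)
    of Vector R V := {
  lie : V -> V -> V;
  lie_bilinear : bilinear_for
    (GRing.Scale.Law.clone _ _ *:%R _) (GRing.Scale.Law.clone _ _ *:%R _) lie;
  liexx : forall x : V, lie x x = 0;
  lie_jacobi : forall x y z : V,
    lie x (lie y z) + lie y (lie z x) + lie z (lie x y) = 0
}.

#[short(type="lieAlgType")]
HB.structure Definition LieAlgebra (R : fieldType) :=
  {V of Vector R V & Vector_isLieAlgebra R V}.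

HB.instance Definition _ (R : fieldType) (V : lieAlgType R) :=
  bilinear_isBilinear.Build R V V V _ _ (@lie R V) (@lie_bilinear R V).

Section ExteriorCalculus.
Variables (R : numFieldType) (V : lieAlgType R).

(* Functions of k vectors.  Neither multilinearity nor alternation is part of
   the type; k-forms are the cochains having both properties, and the
   operations below send forms to forms. *)
Definition cochain (k : nat) := {ffun 'I_k -> V} -> R.

Definition one_form (a : 'Hom(V, R^o)) : cochain 1 := fun X => a (X ord0).

(* (a /\ b)(X_1, .., X_(p+q)) = 1/(p! q!) sum_s sgn(s)
     a(X_s(1), .., X_s(p)) b(X_s(p+1), .., X_s(p+q)),
   so that (a /\ b)(X, Y) = a X * b Y - a Y * b X for 1-forms. *)
Definition wedge (p q : nat) (a : cochain p) (b : cochain q) :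
    cochain (p + q) := fun X =>
  ((p`! * q`!)%N%:R)^-1 *
  \sum_(s : 'S_(p + q)) (-1) ^+ s
    * a [ffun i => X (s (lshift q i))] * b [ffun j => X (s (rshift p j))].

(* (d w)(X_0, .., X_(k+1)) = sum_(i < j) (-1)^(i+j)
     w([X_i, X_j], X_0, .., omit X_i, .., omit X_j, .., X_(k+1)),
   for w of positive degree k+1.  The index i ranges over 'I_k.+1: as i < j,
   lift j i has value i, and lift j \o lift i enumerates increasingly the
   indices other than i and j. *)
Definition CEdiff (k : nat) (w : cochain k.+1) : cochain k.+2 := fun X =>
  \sum_(j < k.+2) \sum_(i < k.+1 | (i < j)%N) (-1) ^+ (i + j) *
    w [ffun m => if unlift ord0 m is Some m' then X (lift j (lift i m'))
                 else lie (X (lift j i)) (X j)].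

Definition is_h5 : Prop :=
  exists e1 e2 e3 e4 e5 e6 : 'Hom(V, R^o),
    let w a b := wedge (one_form a) (one_form b) in
    [/\ basis_of {:'Hom(V, R^o)} [:: e1; e2; e3; e4; e5; e6],
        forall e, e \in [:: e1; e2; e3; e4] ->
          forall X, CEdiff (one_form e) X = 0,
        forall X, CEdiff (one_form e5) X = w e1 e3 X + w e4 e2 X
      & forall X, CEdiff (one_form e6) X = w e1 e4 X + w e2 e3 X].

Definition complex_structure (J : 'End(V)) : Prop :=
  (forall X, J (J X) = - X) /\
  (forall X Y, lie (J X) (J Y) = J (lie (J X) Y) + J (lie X (J Y)) + lie X Y).

Definition abelian_complex_structure (J : 'End(V)) : Prop :=
  complex_structure J /\ forall X Y, lie (J X) (J Y) = lie X Y.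

End ExteriorCalculus.

Section Metrics.
Variables (R : realFieldType) (V : lieAlgType R).
Variables (J : 'End(V)) (g : {dot V for idfun}).

Definition hermitian_metric : Prop := forall X Y, g X Y = g (J X) (J Y).

Definition fundamental_form : cochain V 2 :=
  fun X => g (X ord0) (J (X ord_max)).

(* The balanced condition in real dimension 6; for the fundamental form F of a
   Hermitian metric in real dimension 2n it reads d(F^(n-1)) = 0. *)
Definition balanced : Prop :=
  forall X, CEdiff (wedge fundamental_form fundamental_form) X = 0.

End Metrics.

(* Main.v *)
From HB Require Import structures.
Require Import Defs.
From mathcomp Require Import all_boot all_order all_algebra fingroup perm.
From mathcomp Require Import boolp reals ring.

(** The algebra [h5] is the complex Heisenberg algebra seen over the reals: it
carries an endomorphism [I] with [I^2 = -1] for which the bracket is complex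
bilinear ([h5_complex_Lie]).

Let [J] be an abelian complex structure.  Both [[JIx, y]] and [[IJx, y]] are
equal to [-I[x, Jy]], so [I] and [J] commute modulo the centre
([central_commutator]).  Modulo the centre [J] is thus a complex linear map of
square [-1], and the quotient is the sum of the part where [J = I] and the part
where [J = -I].  If [x] lies in either part, then [[x, Jx] = [x, +-Ix]] is
[+-I[x, x] = 0].  Neither part is the whole quotient, since then the abelian
condition [[Jx, Jy] = [x, y]] and [[Ix, Iy] = -[x, y]] would make all brackets
vanish; so neither part is zero ([noncentral_linear_part]).  Noncentral vectors [p] and [q] in the two parts, together with a nonzero bracket [c], give
a basis [p, Jp, q, Jq, c, Jc] in which [[p, Jp] = [q, Jq] = 0] and all brackets
are combinations of [c] and [Jc] ([abelian_h5_adapted_basis]).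

The metric making this basis orthonormal is Hermitian.  Its fundamental form is
[F = F' + F''], with [F'] on [p, Jp, q, Jq] and [F''] on [c, Jc].  As [F'] is
closed and [F'' /\ F'' = 0], one has [d(F /\ F) = 2 F' /\ dF''].  The components
of the bracket, from which [dF''] is made, are combinations of
[p^* /\ q^* + Jp^* /\ Jq^*] and [p^* /\ Jq^* - Jp^* /\ q^*], because
[[p, Jp]] and [[q, Jq]] vanish, and the wedge of [F'] with either of these
2-forms is zero, so [F] is balanced ([balanced_of_unitary_basis]). *)

Set Implicit Arguments.
Unset Strict Implicit.
Unset Printing Implicit Defensive.

Import Order.TTheory GRing.Theory Num.Theory.
Local Open Scope ring_scope.

(** * Sums over small symmetric groups *)

Lemma lift_perm_bij n :
  bijective (fun p : 'I_n.+1 * 'S_n => lift_perm ord0 p.1 p.2).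
Proof.
apply: inj_card_bij => [[i s] [j t] /= eq_st|]; last first.
  by rewrite card_prod card_ord !card_Sn factS.
have eq_ij : i = j by have /permP/(_ ord0) := eq_st; rewrite !lift_perm_id.
rewrite eq_ij in eq_st *; congr (_, _); apply/permP => k.
have /permP/(_ (lift ord0 k)) := eq_st.
by rewrite !lift_perm_lift => /lift_inj.
Qed.

(** Grouping the permutations by the image of the first index makes explicit
expansions of alternating sums mechanical. *)
Lemma sum_perm_recl (R : nmodType) n (G : 'S_n.+1 -> R) :
  \sum_s G s = \sum_i \sum_(s : 'S_n) G (lift_perm ord0 i s).
Proof.
rewrite (reindex _ (onW_bij _ (lift_perm_bij n))) /=.
by rewrite -(pair_bigA _ (fun i s => G (lift_perm ord0 i s))).
Qed.

Lemma sum_perm0 (R : nmodType) (G : 'S_0 -> R) : \sum_s G s = G 1%g.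
Proof.
by rewrite (big_pred1 1%g) // => s; apply/esym/eqP/permP; case.
Qed.

Lemma inord4E :
  (inord 0 = ord0 :> 'I_4) * (inord 1 = lift ord0 ord0 :> 'I_4) *
  (inord 2 = lift ord0 (lift ord0 ord0) :> 'I_4) *
  (inord 3 = lift ord0 (lift ord0 (lift ord0 ord0)) :> 'I_4).
Proof. by do !split; apply/val_inj; rewrite /= inordK. Qed.

(** This is eight times the Pfaffian of [f]: each of the three perfect matchings
of four indices arises from eight permutations. *)
Lemma sum_perm4_alternating (R : comNzRingType) (f : nat -> nat -> R) :
  (forall i j, f i j = - f j i) ->
  \sum_(s : 'S_4)
    (-1) ^+ s * f (s (inord 0)) (s (inord 1)) * f (s (inord 2)) (s (inord 3)) =
  8%:R * (f 0%N 1%N * f 2 3 - f 0%N 2 * f 1%N 3 + f 0%N 3 * f 1%N 2).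
Proof.
move=> f_alt; rewrite !inord4E.
rewrite sum_perm_recl; under eq_bigr => i1 _.
  rewrite sum_perm_recl; under eq_bigr => i2 _.
    rewrite sum_perm_recl; under eq_bigr => i3 _.
      rewrite sum_perm_recl; under eq_bigr => i4 _.
        rewrite sum_perm0 !(lift_perm_lift, lift_perm_id).
        rewrite !(odd_lift_perm, odd_perm1) /=.
        over.
      over.
    over.
  over.
rewrite !big_ord_recl !big_ord0 /= /bump /=.
rewrite (f_alt 1 0)%N (f_alt 2 0)%N (f_alt 2 1)%N.
rewrite (f_alt 3 0)%N (f_alt 3 1)%N (f_alt 3 2)%N.
ring.
Qed.

(** * Wedge products and differentials in low degree *)

Section LowDegree.
Variables (R : numFieldType) (V : lieAlgType R).

Lemma wedge_one_formE (a b : 'Hom(V, R^o)) (X : {ffun 'I_2 -> V}) :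
  wedge (one_form a) (one_form b) X =
  a (X ord0) * b (X (lift ord0 ord0)) - a (X (lift ord0 ord0)) * b (X ord0).
Proof.
rewrite /wedge /one_form sum_perm_recl.
under eq_bigr => i1 _.
  rewrite sum_perm_recl; under eq_bigr => i2 _.
    rewrite sum_perm0 !ffunE.
    have -> : @lshift 1 1 ord0 = ord0 by exact/val_inj.
    have -> : @rshift 1 1 ord0 = lift ord0 ord0 by exact/val_inj.
    rewrite !(lift_perm_lift, lift_perm_id, odd_lift_perm, odd_perm1).
    over.
  over.
rewrite !big_ord_recl !big_ord0 /=.
have -> : lift (lift ord0 ord0) ord0 = ord0 :> 'I_2 by exact/val_inj.
by rewrite invr1 !addr0 expr0 expr1 !mul1r mulN1r mulNr.
Qed.

Lemma CEdiff_one_formE (a : 'Hom(V, R^o)) (X : {ffun 'I_2 -> V}) :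
  CEdiff (one_form a) X = - a (lie (X ord0) (X (lift ord0 ord0))).
Proof.
rewrite /CEdiff /one_form 2!big_ord_recl !big_ord0 /=.
rewrite big_pred0 => [|i]; last by rewrite ltn0.
rewrite (big_pred1 ord0) => [|i]; last by rewrite [i]ord1.
rewrite ffunE unlift_none.
have -> : lift (lift ord0 ord0) ord0 = ord0 :> 'I_2 by exact/val_inj.
by rewrite add0r addr0 expr1 mulN1r.
Qed.

(** Writing a 4-cochain as a function of four separate vectors avoids finite
functions in the ten terms of its differential. *)
Lemma CEdiff4E (w : cochain V 4) (psi : V -> V -> V -> V -> R)
    (X : {ffun 'I_5 -> V}) (x := fun i => X (inord i)) :
  (forall Y : {ffun 'I_4 -> V},
    w Y = psi (Y (inord 0)) (Y (inord 1)) (Y (inord 2)) (Y (inord 3))) ->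
  let l i j := lie (x i) (x j) in
  CEdiff w X =
    - psi (l 0%N 1%N) (x 2%N) (x 3%N) (x 4%N)
    + psi (l 0%N 2%N) (x 1%N) (x 3%N) (x 4%N)
    - psi (l 1%N 2%N) (x 0%N) (x 3%N) (x 4%N)
    - psi (l 0%N 3%N) (x 1%N) (x 2%N) (x 4%N)
    + psi (l 1%N 3%N) (x 0%N) (x 2%N) (x 4%N)
    - psi (l 2%N 3%N) (x 0%N) (x 1%N) (x 4%N)
    + psi (l 0%N 4%N) (x 1%N) (x 2%N) (x 3%N)
    - psi (l 1%N 4%N) (x 0%N) (x 2%N) (x 3%N)
    + psi (l 2%N 4%N) (x 0%N) (x 1%N) (x 3%N)
    - psi (l 3%N 4%N) (x 0%N) (x 1%N) (x 2%N).
Proof.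
move=> wE l.
have xE i : X i = x i by rewrite /x inord_val.
rewrite /CEdiff.
under eq_bigr => j _.
  under eq_bigr => i _.
    rewrite wE !ffunE !inord4E unlift_none !liftK !xE /=.
    over.
  over.
under eq_bigr do rewrite big_mkcond !big_ord_recl big_ord0 /=.
rewrite !big_ord_recl !big_ord0 /= /bump /= /l.
ring.
Qed.

End LowDegree.

Lemma wedge_fundamental_square (R : realFieldType) (V : lieAlgType R)
    (J : 'End(V)) (g : {dot V for idfun}) (F := fun x y => g x (J y))
    (X : {ffun 'I_4 -> V}) :
  (forall x y, F x y = - F y x) ->
  wedge (fundamental_form J g) (fundamental_form J g) X =
  2 * (F (X (inord 0)) (X (inord 1)) * F (X (inord 2)) (X (inord 3))
     - F (X (inord 0)) (X (inord 2)) * F (X (inord 1)) (X (inord 3))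
     + F (X (inord 0)) (X (inord 3)) * F (X (inord 1)) (X (inord 2))).
Proof.
move=> F_alt; pose f i j := F (X (inord i)) (X (inord j)).
have f_alt i j : f i j = - f j i by exact: F_alt.
rewrite /wedge /fundamental_form.
under eq_bigr => s _.
  rewrite !ffunE -/(F _ _) -/(F _ _).
  have -> : @lshift 2 2 ord0 = inord 0.
    by apply/val_inj; rewrite /= inordK.
  have -> : @lshift 2 2 ord_max = inord 1.
    by apply/val_inj; rewrite /= inordK.
  have -> : @rshift 2 2 ord0 = inord 2.
    by apply/val_inj; rewrite /= inordK.
  have -> : @rshift 2 2 ord_max = inord 3.
    by apply/val_inj; rewrite /= inordK.
  rewrite (_ : F _ _ = f (s (inord 0)) (s (inord 1))); last first.
    by rewrite /f !inord_val.
  rewrite (_ : F _ _ = f (s (inord 2)) (s (inord 3))); last first.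
    by rewrite /f !inord_val.
  over.
rewrite (sum_perm4_alternating f_alt) /f.
have -> : (2`! * 2`!)%N = 4 by [].
by field.
Qed.

(** * Vector identities and inner products *)

Section VectorSpace.
Variables (R : realFieldType) (V : vectType R).
Implicit Types x y : V.

(** Testing on linear forms turns an identity between vectors into a
commutative ring identity; the quantified [f] comes with its linearity as
rewriting rules. *)
Lemma eq_linear_form x y :
  (forall f : V -> R, {morph f : u v / u + v} ->
     (forall a u, f (a *: u) = a * f u) -> {morph f : u / - u} -> f 0 = 0 ->
     f x = f y) -> x = y.
Proof.
move=> eq_xy; rewrite (coord_vbasis (memvf x)) (coord_vbasis (memvf y)).
apply: eq_bigr => i _; congr (_ *: _); apply: eq_xy => [u v|a u|u|].
- by rewrite linearD.
- by rewrite linearZ.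
- by rewrite linearN.
- by rewrite linear0.
Qed.

(* Linearity rules keyed on endomorphisms: the generic ones would also be tried
   on every other function in the large sums below. *)
Lemma endoD (f : 'End(V)) x y : f (x + y) = f x + f y.
Proof. exact: linearD. Qed.

Lemma endoN (f : 'End(V)) x : f (- x) = - f x.
Proof. exact: linearN. Qed.

Lemma endoZ (f : 'End(V)) a x : f (a *: x) = a *: f x.
Proof. exact: linearZ. Qed.

Definition endoE := (endoD, endoN, endoZ).

Lemma orthonormalizing_dot n (b : n.-tuple V) :
  basis_of {:V} b ->
  exists g : {dot V for idfun},
    forall x y, g x y = \sum_i coord b i x * coord b i y.
Proof.
move=> b_basis; pose f x y := \sum_i coord b i x * coord b i y.
have f_sym x y : f x y = (-1) ^+ false * idfun (f y x).
  by rewrite expr0 mul1r /f; apply: eq_bigr => i _; rewrite mulrC.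
have fr_lin u : linear_for *%R (f u).
  move=> a x y; rewrite /f mulr_sumr -big_split; apply: eq_bigr => i _ /=.
  by rewrite linearP /= mulrDr mulrCA.
have fl_lin u : linear_for *%R (f ^~ u).
  move=> a x y /=; rewrite /f mulr_sumr -big_split; apply: eq_bigr => i _ /=.
  by rewrite linearP /= mulrDl mulrA.
have f_pos u : u != 0 -> 0 < f u u.
  move=> u_neq0; rewrite lt_def sumr_ge0 ?andbT => [|i _]; last first.
    by rewrite -expr2 sqr_ge0.
  apply: contraNneq u_neq0 => /eqP.
  rewrite psumr_eq0 => [/allP fu0|i _]; last by rewrite -expr2 sqr_ge0.
  rewrite (coord_basis b_basis (memvf u)) big1 // => i _.
  have := fu0 i; rewrite mem_index_enum mulf_eq0 orbb => /(_ isT)/eqP ->.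
  by rewrite scale0r.
pose fB := isBilinear.Build R V V R *%R (idfun \; *%R) f
  (fun u => zmod_morphism_linear (fl_lin u))
  (fun u => zmod_morphism_linear (fr_lin u))
  (fun u => scalable_linear (fl_lin u))
  (fun u => scalable_linear (fr_lin u)).
pose fH := isHermitianSesquilinear.Build R V false idfun f f_sym.
pose fD := isDotProduct.Build R V f f_pos.
pose g : {dot V for idfun} := HB.pack f fB fH fD.
by exists g.
Qed.

Lemma sum_scale_nth6 (r : 'I_6 -> R) (s : seq V) :
  \sum_i r i *: s`_i =
    r (inord 0) *: s`_0 + r (inord 1) *: s`_1 + r (inord 2) *: s`_2
    + r (inord 3) *: s`_3 + r (inord 4) *: s`_4 + r (inord 5) *: s`_5.
Proof.
rewrite !big_ord_recl big_ord0 addr0 /= !addrA.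
by do !congr (_ + _); congr (r _ *: _); apply/val_inj; rewrite /= inordK.
Qed.

(** A basis [e] of the dual space yields linear coordinates [ev] on [V]; the
inverse [E] sends the standard basis to the basis of [V] dual to [e]. *)
Lemma dual_basis_coordinates n (e : n.-tuple 'Hom(V, R^o)) :
  basis_of {:'Hom(V, R^o)} e ->
  \dim {:V} = n /\
  exists (ev : 'Hom(V, 'rV[R]_n)) (E : 'Hom('rV[R]_n, V)),
    [/\ forall x i, ev x 0 i = tnth e i x, cancel ev E & cancel E ev].
Proof.
move=> e_basis.
have dimV : \dim {:V} = n.
  have := size_basis e_basis; rewrite !dimvf /dim /=.
  by rewrite muln1.
have e_inj (x y : V) : (forall i, tnth e i x = tnth e i y) -> x = y.
  move=> exy.
  have f_eq (f : 'Hom(V, R^o)) : f x = f y.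
    rewrite (coord_basis e_basis (memvf f)) !sum_lfunE.
    apply: eq_bigr => i _; rewrite !scale_lfunE; congr (_ *: _).
    by have := exy i; rewrite (tnth_nth 0).
  rewrite (coord_vbasis (memvf x)) (coord_vbasis (memvf y)).
  apply: eq_bigr => i _; congr (_ *: _).
  by have := f_eq (linfun (coord (vbasis {:V}) i : V -> R^o)); rewrite !lfunE.
split=> //.
pose ev (x : V) : 'rV[R]_n := \row_i tnth e i x.
have ev_lin : linear ev.
  by move=> a x y; apply/rowP => i; rewrite !mxE linearP.
pose evM := GRing.isLinear.Build _ _ _ _ ev ev_lin.
pose evL : {linear V -> 'rV[R]_n} := HB.pack ev evM.
pose phi := linfun evL.
have phi_ker : lker phi == 0%VS.
  apply/lker0P => x y; rewrite !lfunE => /rowP phi_xy; apply: e_inj => i.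
  by have := phi_xy i; rewrite !mxE.
have phi_img : limg phi = fullv.
  apply/eqP; rewrite eqEdim subvf /= limg_dim_eq ?(eqP phi_ker) ?capv0 //.
  by rewrite dimV dimvf /dim /= mul1n.
exists phi, (phi^-1)%VF; split=> [x i||u].
- by rewrite lfunE /= mxE.
- exact: lker0_lfunK.
- by apply: limg_lfunVK; rewrite phi_img memvf.
Qed.

(** If [P] is a [J]-stable subspace, a real combination of [x] and [Jx] is [x]
times a complex number, and dividing by that number shows that [P] contains
[x] as soon as it contains a nonzero such combination. *)
Lemma rotation_indep (J : 'End(V)) (P : V -> Prop) x a b :
  (forall z, J (J z) = - z) ->
  P 0 -> (forall k y z, P y -> P z -> P (k *: y + z)) ->
  (forall z, P z -> P (J z)) ->
  ~ P x -> P (a *: x + b *: J x) -> a = 0 /\ b = 0.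
Proof.
move=> JJ P0 Plin PJ nPx Pr.
have P_norm : P ((a ^+ 2 + b ^+ 2) *: x).
  (* multiplication by the conjugate a - bJ *)
  have := Plin (- b) _ _ (PJ _ Pr) (Plin a _ _ Pr P0).
  congr P; rewrite !endoE JJ; apply: eq_linear_form => f fD fZ fN f0.
  by rewrite !(fD, fN, fZ, f0); ring.
have norm0 : a ^+ 2 + b ^+ 2 = 0.
  apply: contrapT => /eqP n0; apply: nPx.
  have := Plin (a ^+ 2 + b ^+ 2)^-1 _ _ P_norm P0.
  by rewrite addr0 scalerA mulVf // scale1r.
move/eqP: norm0; rewrite paddr_eq0 ?sqr_ge0 // !sqrf_eq0.
by case/andP => /eqP -> /eqP ->.
Qed.

End VectorSpace.

Ltac vector_ring :=
  let fD := fresh in let fZ := fresh in let fN := fresh in let f0 := fresh in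
  apply: eq_linear_form => ? fD fZ fN f0; rewrite !(fD, fN, fZ, f0); ring.

(** * The centre of a Lie algebra *)

Section Centre.
Variables (R : realFieldType) (V : lieAlgType R).
Implicit Types x y z : V.

Definition central x := forall y, lie x y = 0.

Lemma lieDl x y z : lie (x + y) z = lie x z + lie y z.
Proof. exact: linearDl. Qed.

Lemma lieZl a x y : lie (a *: x) y = a *: lie x y.
Proof. exact: linearZl_LR. Qed.

Lemma lieDr x y z : lie x (y + z) = lie x y + lie x z.
Proof. exact: linearDr. Qed.

Lemma lieZr a x y : lie x (a *: y) = a *: lie x y.
Proof. exact: linearZr_LR. Qed.

Lemma lieNl x y : lie (- x) y = - lie x y.
Proof. exact: linearNl. Qed.

Lemma lieNr x y : lie x (- y) = - lie x y.
Proof. exact: linearNr. Qed.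

Lemma lieC x y : lie x y = - lie y x.
Proof.
apply/eqP; rewrite -addr_eq0; apply/eqP.
by have := liexx (x + y); rewrite lieDl !lieDr !liexx add0r addr0.
Qed.

Lemma central0 : central (0 : V).
Proof. by move=> y; exact: linear0l. Qed.

Lemma central_lin a x y : central x -> central y -> central (a *: x + y).
Proof. by move=> cx cy z; rewrite lieDl lieZl cx cy scaler0 addr0. Qed.

Lemma centralD x y : central x -> central y -> central (x + y).
Proof. by move=> cx cy; have := central_lin 1 cx cy; rewrite scale1r. Qed.

Lemma centralN x : central x -> central (- x).
Proof. by move=> cx y; rewrite lieNl cx oppr0. Qed.

Lemma central_shiftl x y z : central (x - y) -> lie x z = lie y z.
Proof.
by move=> /(_ z); rewrite lieDl lieNl => /eqP; rewrite subr_eq0 => /eqP.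
Qed.

Lemma central_shiftr x y z : central (x - y) -> lie z x = lie z y.
Proof. by move=> cxy; rewrite lieC (central_shiftl _ cxy) -lieC. Qed.

End Centre.

(** * The complex Lie algebra structure of [h5] *)

Section H5.
Variables (R : realFieldType) (V : lieAlgType R).

Lemma h5_complex_Lie :
  is_h5 V ->
  [/\ \dim {:V} = 6,
      exists I : 'End(V), (forall x, I (I x) = - x) /\
        (forall x y, lie (I x) y = I (lie x y)),
      forall x y : V, central (lie x y)
    & exists x y : V, lie x y != 0].
Proof.
move=> [e1 [e2 [e3 [e4 [e5 [e6 []]]]]]].
set e := [tuple e1; e2; e3; e4; e5; e6].
move=> /(dual_basis_coordinates (e := e))[dimV [ev [E [evE evK EK]]]] d14 d5 d6.
pose xy (x y : V) : {ffun 'I_2 -> V} := [ffun i => if i == ord0 then x else y].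
have lie14 (f : 'Hom(V, R^o)) x y :
    f \in [:: e1; e2; e3; e4] -> f (lie x y) = 0.
  move=> /d14/(_ (xy x y)); rewrite CEdiff_one_formE !ffunE /=.
  by move=> /eqP; rewrite oppr_eq0 => /eqP.
have lie1 x y : e1 (lie x y) = 0 by apply: lie14; rewrite !inE eqxx.
have lie2 x y : e2 (lie x y) = 0 by apply: lie14; rewrite !inE eqxx !orbT.
have lie3 x y : e3 (lie x y) = 0 by apply: lie14; rewrite !inE eqxx !orbT.
have lie4 x y : e4 (lie x y) = 0 by apply: lie14; rewrite !inE eqxx !orbT.
have lie5 x y : e5 (lie x y) =
    - (e1 x * e3 y - e1 y * e3 x + (e4 x * e2 y - e4 y * e2 x)).
  have := d5 (xy x y).
  by rewrite CEdiff_one_formE !wedge_one_formE !ffunE /= => <-; rewrite opprK.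
have lie6 x y : e6 (lie x y) =
    - (e1 x * e4 y - e1 y * e4 x + (e2 x * e3 y - e2 y * e3 x)).
  have := d6 (xy x y).
  by rewrite CEdiff_one_formE !wedge_one_formE !ffunE /= => <-; rewrite opprK.
have ext x y : e1 x = e1 y -> e2 x = e2 y -> e3 x = e3 y -> e4 x = e4 y ->
    e5 x = e5 y -> e6 x = e6 y -> x = y.
  move=> h1 h2 h3 h4 h5 h6; apply: (can_inj evK); apply/rowP => i.
  by rewrite !evE; case: i; do 6?[case=> //].
split=> //.
- (* I is multiplication by i for the complex coordinates e1 + i e2,
     e3 + i e4 and e5 + i e6. *)
  pose s (u : 'rV[R]_6) : 'rV[R]_6 :=
    \row_(i < 6) if odd i then u 0 (inord i.-1) else - u 0 (inord i.+1).
  have s_lin : linear s.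
    move=> a u v; apply/rowP => i; rewrite !mxE; case: ifP => // _.
    by rewrite opprD mulrN.
  pose sM := GRing.isLinear.Build _ _ _ _ s s_lin.
  pose sL : {linear 'rV[R]_6 -> 'rV[R]_6} := HB.pack s sM.
  pose I : 'End(V) := (E \o linfun sL \o ev)%VF.
  have IE i x (lti : (i < 6)%N) : nth 0 e i (I x) =
      if odd i then nth 0 e i.-1 x else - nth 0 e i.+1 x.
    have := evE (I x) (Ordinal lti); rewrite (tnth_nth 0) /= => <-.
    rewrite !comp_lfunE EK lfunE /= mxE /=.
    case: ifP => [|/negbT] i_par; rewrite !evE (tnth_nth 0) inordK //.
      exact: leq_ltn_trans (leq_pred i) lti.
    by move: lti i_par; do 6?[case: i => //= i].
  have I1 x : e1 (I x) = - e2 x by rewrite (IE 0%N).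
  have I2 x : e2 (I x) = e1 x by rewrite (IE 1%N).
  have I3 x : e3 (I x) = - e4 x by rewrite (IE 2%N).
  have I4 x : e4 (I x) = e3 x by rewrite (IE 3%N).
  have I5 x : e5 (I x) = - e6 x by rewrite (IE 4%N).
  have I6 x : e6 (I x) = e5 x by rewrite (IE 5%N).
  exists I; split=> [x|x y].
    by apply: ext; rewrite ?(I1, I2, I3, I4, I5, I6) linearN.
  apply: ext; rewrite ?(I1, I2, I3, I4, I5, I6) ?(lie1, lie2, lie3, lie4);
    rewrite ?oppr0 //.
    by rewrite lie5 lie6 I1 I2 I3 I4; ring.
  by rewrite lie5 lie6 I1 I2 I3 I4; ring.
- move=> x y z; apply: ext;
    rewrite ?(lie5, lie6) ?(lie1, lie2, lie3, lie4) linear0 //.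
    by rewrite ?(mul0r, mulr0, subr0, oppr0, addr0).
  by rewrite ?(mul0r, mulr0, subr0, oppr0, addr0).
- have E_nth u i (lti : (i < 6)%N) : nth 0 e i (E u) = u 0 (Ordinal lti).
    by rewrite -{2}[u]EK evE (tnth_nth 0).
  pose E1 := E (delta_mx 0 (Ordinal (isT : 0 < 6)%N)).
  pose E3 := E (delta_mx 0 (Ordinal (isT : 2 < 6)%N)).
  have e11 : e1 E1 = 1 by rewrite (E_nth _ 0%N) mxE.
  have e33 : e3 E3 = 1 by rewrite (E_nth _ 2%N) mxE.
  have e13 : e1 E3 = 0 by rewrite (E_nth _ 0%N) mxE.
  have e21 : e2 E1 = 0 by rewrite (E_nth _ 1%N) mxE.
  have e23 : e2 E3 = 0 by rewrite (E_nth _ 1%N) mxE.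
  exists E1, E3; apply/eqP => /(congr1 e5).
  rewrite lie5 e11 e33 e13 e21 e23 !(mul0r, mulr0, subr0, addr0) mul1r linear0.
  by move=> /eqP; rewrite oppr_eq0 oner_eq0.
Qed.

End H5.

(** * Abelian complex structures on a complex Lie algebra *)

Section Abelian.
Variables (R : realFieldType) (V : lieAlgType R) (I J : 'End(V)).
Hypotheses (II : forall x, I (I x) = - x).
Hypotheses (IL : forall x y, lie (I x) y = I (lie x y)).
Hypotheses (JJ : forall x, J (J x) = - x).
Hypotheses (JL : forall x y, lie (J x) (J y) = lie x y).
Implicit Types x y z : V.

Lemma lie_Ir x y : lie x (I y) = I (lie x y).
Proof. by rewrite lieC IL -linearN -lieC. Qed.

Lemma lie_Jr x y : lie x (J y) = - lie (J x) y.
Proof. by rewrite -JL JJ lieNr. Qed.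

Lemma central_I x : central x -> central (I x).
Proof. by move=> cx y; rewrite IL cx linear0. Qed.

Lemma central_J x : central x -> central (J x).
Proof. by move=> cx y; rewrite -[lie _ _]opprK -lie_Jr cx oppr0. Qed.

(** Brackets are [I]-linear and [J] is skew for them, so both [[JIx, y]] and
[[IJx, y]] are [-I[x, Jy]]. *)
Lemma central_commutator x : central (J (I x) - I (J x)).
Proof.
move=> y; rewrite lieDl lieNl -[lie (J (I x)) y]opprK -lie_Jr !IL lie_Jr.
by rewrite linearN opprK subrr.
Qed.

(** For [s = 1] and [s = -1], these are the preimages of the subspaces where
[J = I] and where [J = -I] in the quotient by the centre. *)
Definition linear_part (s : R) x := central (J x - s *: I x).

Lemma linear_part_rot s a b x :
  linear_part s x -> linear_part s (a *: x + b *: J x).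
Proof.
move=> px y.
have pJx : central (J (J x) - s *: I (J x)).
  have := centralD (central_J px)
    (central_lin s (central_commutator x) (@central0 _ V)).
  by congr central; rewrite !endoE !JJ; vector_ring.
have := central_lin a px (central_lin b pJx (@central0 _ V)).
by move/(_ y) => <-; congr lie; rewrite !endoE; vector_ring.
Qed.

Lemma linear_part_lie0 s x : linear_part s x -> lie x (J x) = 0.
Proof.
by move=> px; rewrite (central_shiftr _ px) lieZr lie_Ir liexx linear0 scaler0.
Qed.

(** Up to a factor 2, [z - s I J z] is the projection of [z] to the part of
sign [s].  If all these projections were central, [z] could be replaced by
[s I J z] in brackets; doing so in both arguments of [[x, y]] gives
[s^2 I I [Jx, Jy] = -[x, y]], and all brackets would vanish. *)
Lemma noncentral_linear_part s :
  s ^+ 2 = 1 -> (exists x y : V, lie x y != 0) ->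
  exists2 x, ~ central x & linear_part s x.
Proof.
move=> s2 [x [y /eqP xy0]]; apply: contrapT => no_part; apply: xy0.
have part z : linear_part s (z - s *: I (J z)).
  move=> w.
  have := central_lin (- s) (central_commutator (J z)) (@central0 _ V).
  move/(_ w) => <-; congr lie; rewrite !endoE !II !JJ !endoE.
  by rewrite (scalerDr s (I z)) !scalerN !scalerA -expr2 s2; vector_ring.
have shift z : central (z - s *: I (J z)).
  by apply: contrapT => nc; apply: no_part; exists (z - s *: I (J z)).
have : lie x y = - lie x y.
  rewrite {1}(central_shiftl _ (shift x)) (central_shiftr _ (shift y)).
  by rewrite lieZl lieZr scalerA -expr2 s2 scale1r IL lie_Ir II JL.
move/eqP; rewrite -addr_eq0 -mulr2n -scaler_nat scaler_eq0 pnatr_eq0.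
by move=> /eqP.
Qed.

(** The two parts meet in the centre only: if [r + t] is central with [r] and
[t] in the parts of sign [1] and [-1], then so is [(I - J)(r + t)], which is
[2 I t] modulo the centre. *)
Lemma linear_parts_indep p q a b c d :
  ~ central p -> ~ central q -> linear_part 1 p -> linear_part (-1) q ->
  central (a *: p + b *: J p + (c *: q + d *: J q)) ->
  [/\ a = 0, b = 0, c = 0 & d = 0].
Proof.
move=> ncp ncq pp pq.
have := linear_part_rot a b pp; have := linear_part_rot c d pq.
set r := a *: p + _; set t := c *: q + _ => pt pr crt.
have ct : central t.
  have cI : central (I (t *+ 2)).
    have := centralD (centralD pr pt)
      (centralD (central_I crt) (centralN (central_J crt))).
    by congr central; rewrite -scaler_nat !endoE; vector_ring.
  have := central_lin (- 2^-1) (central_I cI) (@central0 _ V).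
  rewrite addr0 II scalerN scaleNr opprK -scaler_nat scalerA mulVf ?scale1r //.
  by rewrite pnatr_eq0.
have cr : central r by have := centralD crt (centralN ct); rewrite addrK.
have indep := rotation_indep JJ (@central0 _ V) (@central_lin _ V) central_J.
have [-> ->] := indep _ _ _ ncp cr.
by have [-> ->] := indep _ _ _ ncq ct.
Qed.

End Abelian.

(** * Adapted bases and balanced metrics *)

Section Balanced.
Variables (R : realFieldType) (V : lieAlgType R) (J : 'End(V)).

Lemma abelian_h5_adapted_basis :
  is_h5 V -> abelian_complex_structure J ->
  exists p q c : V,
    [/\ basis_of {:V} [:: p; J p; q; J q; c; J c],
        lie p (J p) = 0, lie q (J q) = 0, central c
      & forall x y, exists a b, lie x y = a *: c + b *: J c].
Proof.
move=> /h5_complex_Lie[dimV [I [II IL]] nil2 nab] [[JJ _] JL].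
have [|p ncp pp] := noncentral_linear_part II IL JJ JL (s := 1) _ nab.
  by rewrite expr1n.
have [|q ncq pq] := noncentral_linear_part II IL JJ JL (s := -1) _ nab.
  by rewrite sqrrN expr1n.
have [x0 [y0 c_neq0]] := nab; pose c := lie x0 y0.
have cc : central c by exact: nil2.
(* Used below both for linear independence, with z = 0, and to see that
   brackets, being central, have no component on p, Jp, q, Jq. *)
have indep k1 k2 k3 k4 k5 k6 z : central z ->
    z = k1 *: p + k2 *: J p + k3 *: q + k4 *: J q + k5 *: c + k6 *: J c ->
    [/\ k1 = 0, k2 = 0, k3 = 0 & k4 = 0].
  move=> cz zE; apply: (linear_parts_indep II IL JJ JL ncp ncq pp pq).
  have := central_lin (- k5) cc (central_lin (- k6) (central_J JJ JL cc) cz).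
  by congr central; rewrite zE; vector_ring.
pose b := [tuple p; J p; q; J q; c; J c].
have b_basis : basis_of {:V} b.
  rewrite basisEfree subvf dimV leqnn !andbT; apply/freeP => k.
  rewrite sum_scale_nth6 => /esym k_rel.
  have [k0 k1 k2 k3] := indep _ _ _ _ _ _ _ (@central0 _ V) k_rel.
  move: k_rel; rewrite k0 k1 k2 k3 !scale0r !add0r => /esym k_rel.
  have k45 : k (inord 4) = 0 /\ k (inord 5) = 0.
    apply: (rotation_indep (P := fun x : V => x = 0) JJ _ _ _ _ k_rel) => //.
    - by move=> k' y z -> ->; rewrite scaler0 addr0.
    - by move=> z ->; rewrite linear0.
    - exact/eqP.
  case: k45 => k4 k5 i; rewrite -(inord_val i).
  by case: i; do 6?[case=> //].
exists p, q, c; split=> // [||x y].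
- exact: (linear_part_lie0 IL pp).
- exact: (linear_part_lie0 IL pq).
have := coord_basis b_basis (memvf (lie x y)); rewrite sum_scale_nth6 => lieE.
have [k0 k1 k2 k3] := indep _ _ _ _ _ _ _ (nil2 x y) lieE.
rewrite lieE k0 k1 k2 k3 !scale0r !add0r.
by eexists; eexists.
Qed.

(** In coordinates, [F] is a sum of one term per pair [(x, Jx)] of the basis,
and the bracket involves [p, Jp, q, Jq] only through [A] and [B]; each wedge of
[A] or [B] with the [p, Jp, q, Jq] part of [F] cancels. *)
Lemma balanced_of_unitary_basis (p q c : V)
    (b := [tuple p; J p; q; J q; c; J c]) :
  (forall x, J (J x) = - x) -> (forall x y, lie (J x) (J y) = lie x y) ->
  basis_of {:V} b -> lie p (J p) = 0 -> lie q (J q) = 0 -> central c ->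
  (forall x y, exists a b, lie x y = a *: c + b *: J c) ->
  exists g : {dot V for idfun}, hermitian_metric J g /\ balanced J g.
Proof.
move=> JJ JL b_basis pJp qJq cc lie_c.
have [g gE] := orthonormalizing_dot b_basis.
pose k i x := coord b (inord i) x.
have xE x : x = k 0%N x *: p + k 1%N x *: J p + k 2%N x *: q + k 3%N x *: J q
    + k 4%N x *: c + k 5%N x *: J c.
  by rewrite {1}(coord_basis b_basis (memvf x)) sum_scale_nth6.
have kE x (s : seq R) :
    x = s`_0 *: p + s`_1 *: J p + s`_2 *: q + s`_3 *: J q
      + s`_4 *: c + s`_5 *: J c ->
    forall i, (i < 6)%N -> k i x = s`_i.
  move=> -> i lti.
  have := coord_sum_free (fun j : 'I_6 => s`_j) (inord i) (basis_free b_basis).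
  by rewrite sum_scale_nth6 !inordK.
have gkE x y : g x y = k 0%N x * k 0%N y + k 1%N x * k 1%N y + k 2%N x * k 2%N y
    + k 3%N x * k 3%N y + k 4%N x * k 4%N y + k 5%N x * k 5%N y.
  rewrite gE !big_ord_recl big_ord0 addr0 !addrA.
  by do !congr (_ + _); congr (coord b _ x * coord b _ y);
    apply/val_inj; rewrite /= inordK.
have kJ x i : (i < 6)%N -> k i (J x) =
    [:: - k 1%N x; k 0%N x; - k 3%N x; k 2%N x; - k 5%N x; k 4%N x]`_i.
  by apply: kE; rewrite /= {1}(xE x) !endoE !JJ; vector_ring.
pose F x y := g x (J y).
have FE x y : F x y = k 1%N x * k 0%N y - k 0%N x * k 1%N y
    + k 3%N x * k 2%N y - k 2%N x * k 3%N y
    + k 5%N x * k 4%N y - k 4%N x * k 5%N y.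
  by rewrite /F gkE !kJ //=; ring.
have F_alt x y : F x y = - F y x by rewrite !FE; ring.
exists g; split=> [x y|X].
  by rewrite !gkE !kJ //=; ring.
pose psi x y z t := 2 * (F x y * F z t - F x z * F y t + F x t * F y z).
have wE Y := wedge_fundamental_square Y F_alt.
rewrite (CEdiff4E (psi := psi) _ wE) /psi.
have cr x : lie x c = 0 by rewrite lieC cc oppr0.
have cJl x : lie (J c) x = 0 by exact: (central_J JJ JL cc).
have cJr x : lie x (J c) = 0 by rewrite lieC cJl oppr0.
pose A x y :=
  k 0%N x * k 2%N y - k 2%N x * k 0%N y + k 1%N x * k 3%N y - k 3%N x * k 1%N y.
pose B x y :=
  k 0%N x * k 3%N y - k 3%N x * k 0%N y - k 1%N x * k 2%N y + k 2%N x * k 1%N y.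
have lieE x y : lie x y = A x y *: lie p q + B x y *: lie p (J q).
  rewrite {1}(xE x) {1}(xE y) !(lieDl, lieDr, lieZl, lieZr) !(cc, cr, cJl, cJr).
  rewrite !JL !liexx pJp qJq (lieC (J p) p) (lieC (J q) q) pJp qJq.
  rewrite (lieC q p) (lieC q (J p)) (lieC (J q) p).
  rewrite -[lie (J p) q]opprK -(lie_Jr JJ JL).
  by rewrite /A /B; vector_ring.
have [a [a' pqE]] := lie_c p q; have [d [d' pJqE]] := lie_c p (J q).
have klie x y i : (i < 6)%N -> k i (lie x y) =
    [:: 0; 0; 0; 0; A x y * a + B x y * d; A x y * a' + B x y * d']`_i.
  by apply: kE; rewrite /= lieE pqE pJqE; vector_ring.
have F_lie x y z : F (lie x y) z =
    (A x y * a' + B x y * d') * k 4%N z - (A x y * a + B x y * d) * k 5%N z.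
  by rewrite FE !klie //=; ring.
rewrite !F_lie !FE /A /B.
(* The identity is polynomial in the coordinates of the five vectors; with
   these as variables, its normalisation is much faster. *)
repeat match goal with |- context [k ?i ?x] => move: (k i x) => ? end.
ring.
Qed.

End Balanced.

Theorem corollary2p9 (R : realType) (h : lieAlgType R) (J : 'End(h)) :
  is_h5 h -> abelian_complex_structure J ->
  exists g : {dot h for idfun}, hermitian_metric J g /\ balanced J g.
Proof.
move=> h5 J_ab.
have [p [q [c [b_basis pJp qJq cc lie_c]]]] := abelian_h5_adapted_basis h5 J_ab.
have [[JJ _] JL] := J_ab.
exact: (balanced_of_unitary_basis JJ JL b_basis pJp qJq cc lie_c).
Qed.
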